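(* Let $p$ be a prime, $n\geq 1$, $\zeta=\zeta_{p^n}$ a primitive $p^n$th root of unity, $T=\mathbb{Z}_{(p)}[\zeta]$ and $t=1-\zeta$. Consider the cyclotomic Dedekind embedding \[ \delta_{p^n}\colon T\otimes_{\mathbb{Z}_{(p)}}T\longrightarrow \prod_{i\in(\mathbb{Z}/p^n)^\ast}T,\qquad \zeta^k\otimes\zeta^l\longmapsto(\zeta^{k+il})_{i\in(\mathbb{Z}/p^n)^\ast}\quad (k,l\in[0,(p-1)p^{n-1}-1]), \] a $T$-linear injective map between free $T$-modules of rank $(p-1)p^{n-1}$ (with $T$ acting on the left tensor factor and componentwise on the product). Let $j\in[0,p^n-1]$ with $p\nmid j$, let $N(j):=\#\{i\in[0,j]: p\nmid i\}$, and write $j=\sum_{s\geq 0}a_sp^s$ with $a_s\in[0,p-1]$. Then the $N(j)$th $T$-linear elementary divisor of $\delta_{p^n}$ has $t$-adic valuation \[ -1+\sum_{s\geq 0}\bigl(a_s(s+1)-a_{s+1}(s+2)\bigr)p^s . \]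
   Context: For an injective $T$-linear map $f\colon M\to N$ between free modules of the same finite rank $r$ over a discrete valuation ring $T$ with uniformizer $t$, there are $T$-bases of $M$ and $N$ in which $f$ is diagonal with entries $t^{e_0},\dots,t^{e_{r-1}}$ (times units), $e_0\le e_1\le\dots\le e_{r-1}$; the $k$th elementary divisor is $t^{e_{k-1}}$, whose valuation is $e_{k-1}$. $\mathbb{Z}_{(p)}$ denotes the localization of $\mathbb{Z}$ at the prime ideal $(p)$. *)

(* Defs.v *)
From HB Require Import structures.
From mathcomp Require Import all_boot all_order all_algebra all_field.
Set Implicit Arguments. Unset Strict Implicit. Unset Printing Implicit Defensive.
Import Order.TTheory GRing.Theory Num.Theory.
Local Open Scope ring_scope.

Definition in_Zloc (p : nat) (q : rat) : bool := ~~ (p%:Z %| denq q)%Z.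

Definition in_T (p : nat) (z x : algC) : Prop :=
  exists c : seq rat, all (in_Zloc p) c /\
    x = \sum_(k < size c) ratr c`_k * z ^+ k.

Definition unit_T (p : nat) (z x : algC) : Prop :=
  in_T p z x /\ x != 0 /\ in_T p z x^-1.

Definition mx_T (p : nat) (z : algC) m n (A : 'M[algC]_(m, n)) : Prop :=
  forall i j, in_T p z (A i j).

Definition GL_T (p : nat) (z : algC) m (A : 'M[algC]_m) : Prop :=
  A \in unitmx /\ mx_T p z A /\ mx_T p z (invmx A).

(* e = [:: e_0; ...; e_{m-1}] (nondecreasing) are the t-adic valuations of the
   elementary divisors of A over the DVR T, t = 1 - z: there are T-bases
   (changes of bases P, Q in GL_m(T)) in which A is diagonal with entries
   u_i * t^{e_i}, u_i units of T. *)
Definition elem_div_exps (p : nat) (z : algC) m (A : 'M[algC]_m) (e : seq nat)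
  : Prop :=
  size e = m /\ sorted leq e /\
  exists P Q : 'M[algC]_m, GL_T p z P /\ GL_T p z Q /\
  exists u : 'I_m -> algC, (forall i, unit_T p z (u i)) /\
    P *m A *m Q = diag_mx (\row_i (u i * (1 - z) ^+ nth 0%N e i)).

Definition phi_pn (p n : nat) : nat := (p.-1 * p ^ n.-1)%N.

Definition units_pn (p n : nat) : seq nat :=
  [seq i <- iota 0 (p ^ n) | ~~ (p %| i)%N].

(* Matrix of the Dedekind embedding delta_{p^n} with respect to the T-basis
   (1 (x) z^l)_{l < phi} of T (x)_{Z_(p)} T (T acting on the left factor) and
   the standard basis (e_i)_{i in (Z/p^n)^*} of prod_i T; row l is the image
   of 1 (x) z^l, i.e. (z^(i l))_i. *)
Definition dedekind_mx (p n : nat) (z : algC) : 'M[algC]_(phi_pn p n) :=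
  \matrix_(l < phi_pn p n, c < phi_pn p n) z ^+ (nth 0%N (units_pn p n) c * l).

Definition Ncount (p j : nat) : nat := count (fun i => ~~ (p %| i)%N) (iota 0 j.+1).

Definition pdigit (p j s : nat) : nat := ((j %/ p ^ s) %% p)%N.

(* -1 + sum_{s >= 0} (a_s (s+1) - a_{s+1} (s+2)) p^s ; for j < p^n all terms
   with s >= n vanish. *)
Definition val_formula (p n j : nat) : int :=
  - 1 + \sum_(s < n)
     (((pdigit p j s * s.+1)%N)%:Z - ((pdigit p j s.+1 * s.+2)%N)%:Z) * (p ^ s)%:Z.

(* Main.v *)
Require Import Defs.
From HB Require Import structures.
From mathcomp Require Import all_boot all_order all_fingroup all_algebra all_field.
From mathcomp Require Import ring zify.
Set Implicit Arguments. Unset Strict Implicit. Unset Printing Implicit Defensive.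
Import Order.TTheory GRing.Theory Num.Theory.
Local Open Scope ring_scope.

(** The matrix is the Vandermonde matrix at the nodes [z^u], [u] prime to [p].
    Since [1 - z^d] is a unit times [t^(p^(v_p d))], differences of nodes have
    valuation [p^(v_p(x - y))]. Counting solutions of [y = x mod p^s] shows that
    the increasing order on the nodes is a p-ordering, so that Newton
    interpolation triangularizes the matrix and the elementary divisor attached
    to [j] is [prod_{y < j} (z^j - z^y)], of valuation
    [N(j) - 1 + sum_{s >= 1} (p^s - p^(s-1)) floor(j / p^s)]. Writing the digits
    of [j] as [a_s = floor(j / p^s) - p floor(j / p^(s+1))] turns this into the
    stated formula by telescoping. *)

(** * The ring [T], its units, and matrices over it *)

Lemma in_Zloc_div (p : nat) (a N : int) :
  prime p -> ~~ (p%:Z %| N)%Z -> in_Zloc p (a%:~R / N%:~R).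
Proof.
move=> p_pr pN; set q : rat := a%:~R / N%:~R.
have N0 : N%:~R != 0 :> rat.
  by rewrite intr_eq0; apply: contraNneq pN => ->; rewrite dvdz0.
have qN : numq q * N = a * denq q.
  by apply/eqP; rewrite -(eqr_int rat) !rmorphM /= numqE mulrAC divfK.
have : (denq q %| N)%Z.
  rewrite -(@Gauss_dvdzr _ (numq q)); last first.
    by rewrite coprimezE coprime_sym coprime_num_den.
  by rewrite qN dvdz_mull.
by move=> dN; apply: contra pN => /dvdz_trans; apply.
Qed.

Lemma Ndvdz_mul (p : nat) (a b : int) : prime p ->
  ~~ (p%:Z %| a)%Z -> ~~ (p%:Z %| b)%Z -> ~~ (p%:Z %| a * b)%Z.
Proof. by move=> p_pr; rewrite !dvdzE abszM Euclid_dvdM //= negb_or => -> ->. Qed.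

(** Clearing denominators reduces membership to integer polynomials, where closure under sums and
    products is immediate. Coefficient lists have arbitrary length, so no reduction modulo the
    minimal polynomial of [z] is involved. *)
Lemma in_TP (p : nat) (z x : algC) : prime p ->
  in_T p z x <->
  exists2 N : int, ~~ (p%:Z %| N)%Z &
  exists f : {poly int}, x * N%:~R = (map_poly intr f).[z].
Proof.
move=> p_pr; split=> [[c [cZ ->]]|[N pN [f xN]]].
  elim: c cZ => [_|a c IH /= /andP[aZ /IH [N pN [f xN]]]].
    exists 1; first by rewrite dvdzE /= dvdn1; case: p p_pr => [|[]].
    by exists 0; rewrite big_ord0 mul0r rmorph0 horner0.
  exists (N * denq a); first exact: Ndvdz_mul.
  exists ((numq a * N)%:P + denq a *: (f * 'X)).
  rewrite big_ord_recl /= expr0 mulr1 mulrDl.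
  rewrite rmorphD /= map_polyC /= map_polyZ /=.
  rewrite [map_poly _ (f * _)]rmorphM /= map_polyX.
  rewrite hornerD hornerC hornerZ hornerM hornerX -xN.
  have -> : ratr a = (numq a)%:~R / (denq a)%:~R :> algC by [].
  have d0 : (denq a)%:~R != 0 :> algC by rewrite intr_eq0 denq_eq0.
  under eq_bigr do rewrite exprSr mulrA.
  rewrite -mulr_suml !rmorphM /=; congr (_ + _); last by ring.
  by field.
have N0 : N%:~R != 0 :> algC.
  by rewrite intr_eq0; apply: contraNneq pN => ->; rewrite dvdz0.
exists [seq a%:~R / N%:~R | a : int <- f]; split.
  by apply/allP => _ /mapP[a _ ->]; apply: in_Zloc_div.
apply: (mulIf N0); rewrite xN mulr_suml size_map.
rewrite horner_coef size_map_inj_poly //; last exact: intr_inj.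
apply: eq_bigr => i _; rewrite coef_map (nth_map 0) //.
by rewrite fmorph_div /= !ratr_int mulrAC divfK.
Qed.

Lemma in_T_horner (p : nat) (z : algC) (f : {poly int}) :
  prime p -> in_T p z (map_poly intr f).[z].
Proof.
move=> p_pr; apply/in_TP => //; exists 1; last by exists f; rewrite mulr1.
by rewrite dvdzE /= dvdn1; case: p p_pr => [|[]].
Qed.

Lemma in_T_int (p : nat) (z : algC) (a : int) : prime p -> in_T p z a%:~R.
Proof. by move=> /(@in_T_horner _ z a%:P); rewrite map_polyC hornerC. Qed.

Lemma in_T_root (p : nat) (z : algC) : prime p -> in_T p z z.
Proof. by move=> /(@in_T_horner _ z 'X); rewrite map_polyX hornerX. Qed.

Lemma in_TD (p : nat) (z x y : algC) :
  prime p -> in_T p z x -> in_T p z y -> in_T p z (x + y).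
Proof.
move=> p_pr /(in_TP _ _ p_pr)[N pN [f xN]] /(in_TP _ _ p_pr)[M pM [g yM]].
apply/in_TP => //; exists (N * M); first exact: Ndvdz_mul.
exists (M *: f + N *: g); rewrite rmorphD /= !map_polyZ hornerD !hornerZ -xN -yM.
by rewrite rmorphM /=; ring.
Qed.

Lemma in_TM (p : nat) (z x y : algC) :
  prime p -> in_T p z x -> in_T p z y -> in_T p z (x * y).
Proof.
move=> p_pr /(in_TP _ _ p_pr)[N pN [f xN]] /(in_TP _ _ p_pr)[M pM [g yM]].
apply/in_TP => //; exists (N * M); first exact: Ndvdz_mul.
exists (f * g); rewrite [map_poly _ _]rmorphM /= hornerM -xN -yM.
by rewrite rmorphM /=; ring.
Qed.

Lemma in_T0 (p : nat) (z : algC) : prime p -> in_T p z 0.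
Proof. by move=> /(@in_T_int _ z 0). Qed.

Lemma in_T1 (p : nat) (z : algC) : prime p -> in_T p z 1.
Proof. by move=> /(@in_T_int _ z 1). Qed.

Lemma in_TN (p : nat) (z x : algC) : prime p -> in_T p z x -> in_T p z (- x).
Proof.
move=> p_pr xT; rewrite -mulN1r; apply: in_TM => //.
exact: (@in_T_int _ z (- 1)).
Qed.

Lemma in_TB (p : nat) (z x y : algC) :
  prime p -> in_T p z x -> in_T p z y -> in_T p z (x - y).
Proof. by move=> p_pr xT yT; apply: in_TD => //; apply: in_TN. Qed.

Lemma in_TX (p : nat) (z x : algC) (k : nat) :
  prime p -> in_T p z x -> in_T p z (x ^+ k).
Proof.
move=> p_pr xT; elim: k => [|k IH]; first exact: in_T1.
by rewrite exprS; apply: in_TM.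
Qed.

Lemma in_T_sum (p : nat) (z : algC) (I : Type) (r : seq I) (P : pred I)
    (F : I -> algC) :
  prime p -> (forall i, P i -> in_T p z (F i)) ->
  in_T p z (\sum_(i <- r | P i) F i).
Proof.
move=> p_pr FT; apply: (big_ind (in_T p z)) => //; first exact: in_T0.
by move=> x y; apply: in_TD.
Qed.

Lemma in_T_prod (p : nat) (z : algC) (I : Type) (r : seq I) (P : pred I)
    (F : I -> algC) :
  prime p -> (forall i, P i -> in_T p z (F i)) ->
  in_T p z (\prod_(i <- r | P i) F i).
Proof.
move=> p_pr FT; apply: (big_ind (in_T p z)) => //; first exact: in_T1.
by move=> x y; apply: in_TM.
Qed.

Lemma unit_T_mul (p : nat) (z x y : algC) :
  prime p -> unit_T p z x -> unit_T p z y -> unit_T p z (x * y).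
Proof.
move=> p_pr [xT [x0 xVT]] [yT [y0 yVT]].
by split; [|split]; rewrite ?mulf_neq0 ?invfM //; apply: in_TM.
Qed.

Lemma unit_T_prod (p : nat) (z : algC) (I : Type) (r : seq I) (P : pred I)
    (F : I -> algC) :
  prime p -> (forall i, P i -> unit_T p z (F i)) ->
  unit_T p z (\prod_(i <- r | P i) F i).
Proof.
move=> p_pr FT; apply: (big_ind (unit_T p z)) => //; last first.
  by move=> x y; apply: unit_T_mul.
by split; [|split]; rewrite ?invr1 ?oner_neq0 //; apply: in_T1.
Qed.

Lemma unit_TX (p : nat) (z x : algC) (k : nat) :
  prime p -> unit_T p z x -> unit_T p z (x ^+ k).
Proof.
move=> p_pr xU; rewrite -[k]card_ord -prodr_const; exact: unit_T_prod.
Qed.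

Lemma mulmx_T (p : nat) (z : algC) (m n r : nat) (A : 'M_(m, n)) (B : 'M_(n, r)) :
  prime p -> mx_T p z A -> mx_T p z B -> mx_T p z (A *m B).
Proof.
by move=> p_pr AT BT i j; rewrite mxE; apply: in_T_sum => // k _; apply: in_TM.
Qed.

Lemma det_T (p : nat) (z : algC) (m : nat) (A : 'M_m) :
  prime p -> mx_T p z A -> in_T p z (\det A).
Proof.
move=> p_pr AT; apply: in_T_sum => // s _; apply: in_TM => //.
  by apply/in_TX/in_TN/in_T1.
exact: in_T_prod.
Qed.

(** The inverse is the adjugate, whose entries are signed minors. *)
Lemma GL_T_det1 (p : nat) (z : algC) (m : nat) (A : 'M_m) :
  prime p -> mx_T p z A -> \det A = 1 -> GL_T p z A.
Proof.
move=> p_pr AT A1; have uA : A \in unitmx by rewrite unitmxE A1 unitr1.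
do 2!split=> //; rewrite /invmx uA A1 invr1 scale1r => i j; rewrite mxE.
apply: in_TM => //; first by apply/in_TX/in_TN/in_T1.
by apply: det_T => // k l; rewrite !mxE.
Qed.

Lemma GL_T_inv (p : nat) (z : algC) (m : nat) (A : 'M_m) :
  GL_T p z A -> GL_T p z (invmx A).
Proof. by rewrite /GL_T unitmx_inv invmxK => -[uA [AT AiT]]. Qed.

Lemma GL_T_mul (p : nat) (z : algC) (m : nat) (A B : 'M_m) :
  prime p -> GL_T p z A -> GL_T p z B -> GL_T p z (A *m B).
Proof.
move=> p_pr [uA [AT AiT]] [uB [BT BiT]].
have uAB : A *m B \in unitmx by rewrite unitmx_mul uA.
split=> //; split; first exact: mulmx_T.
suff -> : invmx (A *m B) = invmx B *m invmx A by apply: mulmx_T.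
apply: (can_inj (mulKmx uAB)).
by rewrite mulmxV // -mulmxA mulKVmx // mulmxV.
Qed.

Lemma unit_T1 (p : nat) (z : algC) : prime p -> unit_T p z 1.
Proof. by move=> p_pr; split; [|split]; rewrite ?invr1 ?oner_neq0 //; apply: in_T1. Qed.

(** * Valuations of [1 - z ^+ d] *)

Lemma one_sub_expr (R : comNzRingType) (x : R) (k : nat) :
  1 - x ^+ k = (\sum_(i < k) x ^+ i) * (1 - x).
Proof. by rewrite -opprB subrX1 mulrC -mulrN opprB. Qed.

Lemma one_sub_prim_root_neq0 (q : nat) (y : algC) :
  (1 < q)%N -> q.-primitive_root y -> 1 - y != 0.
Proof.
move=> q1 y_pr; rewrite subr_eq0 eq_sym -(expr1 y) -(prim_order_dvd y_pr).
by rewrite dvdn1 gtn_eqF.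
Qed.

(** Since [y] is in turn a power of [y ^+ d], each of [1 - y] and [1 - y ^+ d] is a geometric sum
    times the other, and the two sums are mutually inverse. *)
Lemma one_sub_root_coprime (p q : nat) (z y : algC) (d : nat) :
  prime p -> (1 < q)%N -> in_T p z y -> q.-primitive_root y -> coprime d q ->
  exists2 u, unit_T p z u & 1 - y ^+ d = u * (1 - y).
Proof.
move=> p_pr q1 yT y_pr dq.
have yd_pr : q.-primitive_root (y ^+ d) by rewrite prim_root_exp_coprime.
have [i yE] := prim_rootP yd_pr (prim_expr_order y_pr).
pose u := \sum_(i < d) y ^+ i; pose v := \sum_(j < i) (y ^+ d) ^+ j.
have uT : in_T p z u by apply: in_T_sum => // k _; apply: in_TX.
have vT : in_T p z v by apply: in_T_sum => // k _; do 2!apply: in_TX => //.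
have vu : v * u = 1.
  have y1 := one_sub_prim_root_neq0 q1 y_pr.
  apply: (mulIf y1).
  by rewrite mul1r -mulrA -one_sub_expr -one_sub_expr -yE.
have u0 : u != 0.
  by apply: contra_eq_neq vu => ->; rewrite mulr0 eq_sym oner_neq0.
exists u; last exact: one_sub_expr.
by split; [|split] => //; rewrite -(mulr1 u^-1) -vu mulrCA mulVf ?mulr1.
Qed.

Lemma one_sub_root_exp_prime (p m : nat) (z y : algC) :
  prime p -> (1 < m)%N -> in_T p z y -> (p ^ m)%N.-primitive_root y ->
  exists2 u, unit_T p z u & 1 - y ^+ p = u * (1 - y) ^+ p.
Proof.
(* 1 - y^p is the product of the 1 - w y over the p-th roots of unity w, and
   each w y is a power of y with exponent prime to p because m > 1. *)
move=> p_pr m1 yT y_pr; have p0 := prime_gt0 p_pr; have m0 := ltnW m1.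
have pm1 : (p ^ m.-1 * p = p ^ m)%N by rewrite -expnSr prednK.
pose w := y ^+ (p ^ m.-1).
have w_pr : p.-primitive_root w.
  have := dvdn_prim_root y_pr (dvdn_exp m0 (dvdnn p)).
  by rewrite -pm1 mulnK.
have y0 : y != 0 by rewrite (prim_root_eq0 y_pr) -lt0n expn_gt0 p0.
have -> : 1 - y ^+ p = \prod_(k < p) (1 - y ^+ (p ^ m.-1 * k + 1)).
  (* The factorization of X^p - 1 is evaluated at [y^-1] and multiplied by [y ^+ p]. *)
  have /(congr1 (fun f => f.[y^-1])) := factor_Xn_sub_1 w_pr.
  rewrite horner_prod big_mkord hornerD hornerXn hornerN hornerC.
  move/(congr1 ( *%R (y ^+ p))); rewrite mulrBr mulr1 exprVn mulfV ?expf_neq0 //.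
  move=> <-; rewrite -{1}[p]card_ord -prodr_const -big_split /=.
  apply: eq_bigr => k _; rewrite hornerD hornerX hornerN hornerC mulrBr mulfV //.
  by rewrite addn1 exprS exprM.
have uP (k : 'I_p) : exists2 u, unit_T p z u &
    1 - y ^+ (p ^ m.-1 * k + 1) = u * (1 - y).
  apply: (one_sub_root_coprime p_pr _ yT y_pr).
    by rewrite -(exp1n m) ltn_exp2r ?prime_gt1.
  rewrite coprime_sym coprime_pexpl // prime_coprime //.
  rewrite dvdn_addr ?dvdn1 ?gtn_eqF ?prime_gt1 //.
  by apply/dvdn_mulr/dvdn_exp => //; rewrite -subn1 subn_gt0.
have [u uU uE] : exists2 u, unit_T p z u &
    \prod_(k < p) (1 - y ^+ (p ^ m.-1 * k + 1)) = u * \prod_(k < p) (1 - y).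
  elim/big_ind2: _ => [|a b c d [u uU ->] [v vU ->]|k _]; last exact: uP.
    by exists 1; [apply: unit_T1 | rewrite mulr1].
  by exists (u * v); [apply: unit_T_mul | rewrite mulrACA].
by exists u => //; rewrite uE prodr_const card_ord.
Qed.

(** Write d = p^s c with c prime to p. The exponent c only costs a unit, and each of the s
    successive p-th powers raises the difference to the p-th power up to a unit. *)
Lemma one_sub_root_exp (p n : nat) (z : algC) (d : nat) :
  prime p -> (p ^ n)%N.-primitive_root z -> (0 < d)%N -> (logn p d < n)%N ->
  exists2 u, unit_T p z u & 1 - z ^+ d = u * (1 - z) ^+ (p ^ logn p d).
Proof.
move=> p_pr z_pr d0; have zT := in_T_root z p_pr.
have zs_pr s : (s <= n)%N -> (p ^ (n - s))%N.-primitive_root (z ^+ (p ^ s)).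
  move=> sn; have := dvdn_prim_root z_pr (dvdn_exp2l p (leq_subr s n)).
  by rewrite -expnB ?prime_gt0 ?leq_subr // subKn.
have [c pc dE] := pfactor_coprime p_pr d0.
have -> : z ^+ d = z ^+ (p ^ logn p d) ^+ c by rewrite -exprM mulnC -dE.
move: (logn p d) {dE} => s sn.
have [u uU ->] : exists2 u, unit_T p z u &
    1 - z ^+ (p ^ s) ^+ c = u * (1 - z ^+ (p ^ s)).
  apply: (one_sub_root_coprime p_pr _ (in_TX _ p_pr zT) (zs_pr s (ltnW sn))).
    by rewrite -(exp1n (n - s)) ltn_exp2r ?prime_gt1 ?subn_gt0.
  by rewrite coprime_sym coprimeXl.
suff [v vU ->] : exists2 v, unit_T p z v &
    1 - z ^+ (p ^ s) = v * (1 - z) ^+ (p ^ s).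
  by exists (u * v); [apply: unit_T_mul | rewrite mulrA].
elim: s sn {u uU} => [|s IH] sn.
  by exists 1; [apply: unit_T1 | rewrite mul1r].
have [v vU vE] := IH (ltnW sn).
(* [z ^+ (p ^ s)] has order p^(n - s), and its p-th power must still differ from 1. *)
have ns1 : (1 < n - s)%N by rewrite ltn_subRL addn1.
have [u uU uE] :=
  one_sub_root_exp_prime p_pr ns1 (in_TX (p ^ s) p_pr zT) (zs_pr s (ltnW (ltnW sn))).
exists (u * v ^+ p); first by apply: unit_T_mul => //; apply: unit_TX.
by rewrite expnSr exprM uE vE exprMn -exprM mulrA.
Qed.

(** Otherwise p^n, the product of the 1 - z^i for 0 < i < p^n, would be a unit of T. Then N / p^n
    would be an algebraic integer for some N prime to p, hence an integer, which is absurd. *)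
Lemma one_sub_root_nonunit (p n : nat) (z : algC) :
  prime p -> (0 < n)%N -> (p ^ n)%N.-primitive_root z -> ~ in_T p z (1 - z)^-1.
Proof.
move=> p_pr n0 z_pr tT; have zT := in_T_root z p_pr.
have q1 : (1 < p ^ n)%N by rewrite -(exp1n n) ltn_exp2r ?prime_gt1.
have tU : unit_T p z (1 - z).
  split; [|split] => //; first by apply: in_TB => //; apply: in_T1.
  exact: one_sub_prim_root_neq0 q1 z_pr.
have qE : (p ^ n)%:R = \prod_(1 <= i < p ^ n) (1 - z ^+ i).
  (* Cancel X - 1 in the factorization of X^(p^n) - 1, then evaluate at 1. *)
  have := factor_Xn_sub_1 z_pr; rewrite big_ltn ?(ltnW q1) // expr0 subrX1.
  have X1 : 'X - 1%:P != 0 :> {poly algC} by rewrite polyXsubC_eq0.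
  move/(mulfI X1)/(congr1 (fun f => f.[1])); rewrite horner_prod horner_sum.
  under eq_bigr do rewrite hornerXsubC; move=> ->.
  under eq_bigr do rewrite hornerXn expr1n.
  by rewrite sumr_const card_ord.
have [_ [q0 /(in_TP _ _ p_pr)[N pN [f fE]]]] : unit_T p z (p ^ n)%:R.
  rewrite qE big_seq_cond; apply: unit_T_prod => // i.
  rewrite andbT mem_index_iota => /andP[i0 iq].
  have iv : (logn p i < n)%N.
    by rewrite ltnNge -pfactor_dvdn //; apply/negP => /(dvdn_leq i0); rewrite leqNgt iq.
  have [u uU ->] := one_sub_root_exp p_pr z_pr i0 iv.
  by apply: unit_T_mul => //; apply: unit_TX.
have zA : z \in Aint by apply: Aint_prim_root z_pr.
have fA : (map_poly intr f).[z] \in Aint.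
  rewrite horner_coef rpred_sum // => i _.
  by rewrite coef_map rpredM ?rpredX ?Aint_int.
have /intrP[k kE] : (map_poly intr f).[z] \is a Num.int.
  apply: Cint_rat_Aint => //; rewrite -fE.
  by rewrite rpredM ?rpredV ?rpred_nat // rpred_int_num ?intr_int.
case/negP: pN; apply: (@dvdz_trans (p ^ n)%N%:Z).
  by rewrite dvdzE /= dvdn_exp.
suff -> : N = (p ^ n)%N%:Z * k by rewrite dvdz_mulr.
apply/eqP; rewrite -(eqr_int algC) rmorphM /= -kE -fE mulrA.
by rewrite mulfV ?mul1r.
Qed.

(** * Uniqueness of the elementary divisors *)

(** Pigeonhole: otherwise [s] would inject the k + 1 indices up to [k] into the k indices below
    it. *)
Lemma perm_corner (m : nat) (s : {perm 'I_m}) (k : 'I_m) :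
  exists2 i : 'I_m, (i <= k)%N & (k <= s i)%N.
Proof.
apply/exists_inP; apply: contraT => /exists_inPn sk.
pose X := [set i : 'I_m | (i <= k)%N]; pose Y := [set i : 'I_m | (i < k)%N].
have YX : Y \proper X.
  apply/properP; split; first by apply/subsetP => i; rewrite !inE => /ltnW.
  by exists k; rewrite !inE ?ltnn.
have sXY : s @: X \subset Y.
  by apply/subsetP => _ /imsetP[i + ->]; rewrite !inE ltnNge => /sk.
have := leq_ltn_trans (subset_leq_card sXY) (proper_card YX).
by rewrite card_imset ?ltnn //; apply: perm_inj.
Qed.

(** By [perm_corner], every term of the Leibniz expansion has a factor in the corner. *)
Lemma det_corner (p : nat) (z t : algC) (m : nat) (B : 'M_m) (k : 'I_m) :
  prime p -> mx_T p z B ->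
  (forall i j : 'I_m, (i <= k)%N -> (k <= j)%N -> in_T p z (t^-1 * B i j)) ->
  in_T p z (t^-1 * \det B).
Proof.
move=> p_pr BT BtT; rewrite mulr_sumr; apply: in_T_sum => // s _.
have [i ik ksi] := perm_corner s k.
rewrite mulrCA; apply: in_TM => //; first by apply/in_TX/in_TN/in_T1.
rewrite (bigD1 i) //= mulrA; apply: in_TM => //; first exact: BtT.
exact: in_T_prod.
Qed.

(* Two diagonalizations satisfy D B = C D' with B, C in GL_m(T). If e_k < e'_k,
   then t divides B i j for i <= k <= j, hence t divides det B. *)
Lemma elem_div_exps_leq (p : nat) (z : algC) (m : nat) (A : 'M_m)
    (e e' : seq nat) (k : nat) :
  prime p -> 1 - z != 0 -> ~ in_T p z (1 - z)^-1 ->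
  elem_div_exps p z A e -> elem_div_exps p z A e' -> (k < m)%N ->
  (nth 0%N e' k <= nth 0%N e k)%N.
Proof.
move=> p_pr t0 tN [se [e_le [P [Q [PU [QU [u [uU PAQ]]]]]]]].
move=> [se' [e'_le [P' [Q' [P'U [Q'U [u' [u'U PAQ']]]]]]]] km.
rewrite leqNgt; apply/negP => ee'; apply: tN.
have [uP _] := PU; have [uQ _] := QU; have [uP' _] := P'U; have [uQ' _] := Q'U.
have BU := GL_T_mul p_pr (GL_T_inv QU) Q'U.
have [_ [CT _]] := GL_T_mul p_pr PU (GL_T_inv P'U).
set B := invmx Q *m Q' in BU; set C := P *m invmx P' in CT.
have DBC : (P *m A *m Q) *m B = C *m (P' *m A *m Q').
  by rewrite /B /C !mulmxA mulmxK // mulmxKV.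
move: B C DBC BU CT => B C DBC [uB [BT BiT]] CT.
have zT := in_T_root z p_pr.
have tT : in_T p z (1 - z) by apply: in_TB => //; apply: in_T1.
have dB0 : \det B != 0 by rewrite -unitfE -unitmxE.
(* As det B is a unit of T, it is enough that t^-1 det B lies in T. *)
rewrite -[_^-1](mulfK dB0); apply: in_TM => //; last first.
  by rewrite -det_inv; apply: det_T.
apply: (@det_corner _ _ _ _ _ (Ordinal km)) => // i j /= ik kj.
move: DBC; rewrite PAQ PAQ' => /matrixP/(_ i j).
rewrite mul_diag_mx mul_mx_diag !mxE => BC.
have eij : (nth 0%N e i < nth 0%N e' j)%N.
  apply: (leq_ltn_trans (n := nth 0%N e k)).
    by apply: (sorted_leq_nth leq_trans leqnn) => //; rewrite inE se // ltn_ord.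
  apply: (leq_trans ee').
  by apply: (sorted_leq_nth leq_trans leqnn) => //; rewrite inE se' // ltn_ord.
have [uiT [ui0 uiV]] := uU i; have [u'T _] := u'U j.
(* The (i, j) entry of D B = C D' is solved for B_ij / t; by [eij] the subtraction of exponents is
   not truncated. *)
have -> : (1 - z)^-1 * B i j =
    (u i)^-1 * C i j * u' j * (1 - z) ^+ (nth 0%N e' j - (nth 0%N e i).+1).
  apply: (mulfI (mulf_neq0 ui0 (expf_neq0 (nth 0%N e i).+1 t0))).
  move: BC; rewrite -{1}(subnKC eij) exprD exprS.
  move: (_ ^+ (_ - _)) (_ ^+ nth _ _ _) (B i j) (C i j) => a b Bij Cij BC.
  have -> : u i * ((1 - z) * b) * ((1 - z)^-1 * Bij) = u i * b * Bij by field.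
  by rewrite BC; field.
apply: in_TM => //; last exact: in_TX.
by apply: in_TM => //; apply: in_TM.
Qed.

Lemma elem_div_exps_nth (p : nat) (z : algC) (m : nat) (A : 'M_m)
    (e e' : seq nat) (k : nat) :
  prime p -> 1 - z != 0 -> ~ in_T p z (1 - z)^-1 ->
  elem_div_exps p z A e -> elem_div_exps p z A e' -> (k < m)%N ->
  nth 0%N e k = nth 0%N e' k.
Proof.
move=> p_pr t0 tN eA e'A km.
by apply/anti_leq/andP; split; apply: (elem_div_exps_leq p_pr t0 tN _ _ km); eassumption.
Qed.

(** * Valuations of the Newton products *)

(** The sum counts the multiples of [d] in the half-open interval from x - j (excluded) to x. *)
Lemma count_congr (d j x : nat) : (0 < d)%N -> (j <= x)%N ->
  (\sum_(0 <= y < j) (d %| x - y) + (x - j) %/ d = x %/ d)%N.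
Proof.
move=> d0; elim: j => [_|j IH jx]; first by rewrite big_geq // subn0.
rewrite big_nat_recr //= -(IH (ltnW jx)) -addnA; congr (_ + _)%N.
by rewrite -(subnSK jx) divnS.
Qed.

(** A telescoping sum; the divisibility indicator makes the range of [s] independent of [d], so that
    it can be exchanged with a sum over [d]. *)
Lemma expn_logn_sum (p n d : nat) : prime p -> (0 < d)%N -> (logn p d < n)%N ->
  (p ^ logn p d = 1 + \sum_(1 <= s < n) (p ^ s - p ^ s.-1) * (p ^ s %| d))%N.
Proof.
move=> p_pr d0 dn; have p0 := prime_gt0 p_pr.
rewrite (big_cat_nat _ (n := (logn p d).+1)) //=.
rewrite [X in (_ + (_ + X))%N]big1_seq => [|s]; last first.
  by rewrite mem_index_iota => /= /andP[vs _]; rewrite pfactor_dvdn // leqNgt vs muln0.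
rewrite addn0 [X in (_ + X)%N](eq_big_nat _ _ (F2 := fun s => p ^ s - p ^ s.-1)%N).
  elim: (logn p d) => [|v IH]; first by rewrite big_geq.
  rewrite big_nat_recr //= addnA -IH subnKC //.
  by rewrite leq_exp2l // prime_gt1.
by move=> s /andP[_ sv]; rewrite pfactor_dvdn // -ltnS sv muln1.
Qed.

(* The valuation of [prod_{y < j, p not dividing y} (z^y - z^x)]. *)
Definition newton_val (p j x : nat) : nat :=
  \sum_(0 <= y < j | ~~ (p %| y)%N) p ^ logn p (x - y).

(** Sum [expn_logn_sum] over [y]. For s >= 1, any [y] congruent to [x] mod p^s is automatically
    prime to p, so [count_congr] counts them all. *)
Lemma newton_valE (p n j x : nat) :
  prime p -> (j <= x)%N -> (x < p ^ n)%N -> ~~ (p %| x)%N ->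
  (newton_val p j x = \sum_(0 <= y < j | ~~ (p %| y)) 1 +
     \sum_(1 <= s < n) (p ^ s - p ^ s.-1) * (x %/ p ^ s - (x - j) %/ p ^ s))%N.
Proof.
move=> p_pr jx xn px; have p0 := prime_gt0 p_pr.
have n0 : (0 < n)%N by case: n xn px => //; case: x {jx} => //; rewrite dvdn0.
have -> : newton_val p j x = (\sum_(0 <= y < j | ~~ (p %| y))
    (1 + \sum_(1 <= s < n) (p ^ s - p ^ s.-1) * (p ^ s %| x - y)))%N.
  rewrite /newton_val big_seq_cond [RHS]big_seq_cond; apply: eq_bigr => y.
  rewrite mem_index_iota => /andP[/= yj _].
  have xy : (0 < x - y)%N by rewrite subn_gt0 (leq_trans yj).
  apply: expn_logn_sum => //; rewrite ltnNge -pfactor_dvdn //.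
  apply/negP => /(dvdn_leq xy); rewrite leqNgt => /negP[].
  exact: leq_ltn_trans (leq_subr _ _) xn.
rewrite big_split /=; congr (_ + _)%N; rewrite exchange_big /=.
rewrite big_seq_cond [RHS]big_seq_cond; apply: eq_bigr => s.
rewrite mem_index_iota => /andP[/andP[s0 _] _].
rewrite -big_distrr /=; congr (_ * _)%N.
have ps0 : (0 < p ^ s)%N by rewrite expn_gt0 p0.
rewrite -(count_congr ps0 jx) addnK big_mkcond /=.
rewrite big_seq_cond [RHS]big_seq_cond; apply: eq_bigr => y.
rewrite mem_index_iota => /andP[/= yj _]; case: ifP => // /negbFE py.
case: (boolP (p ^ s %| x - y)%N) => // /(dvdn_trans (dvdn_exp s0 (dvdnn p))) pxy.
by move: px; rewrite -(subnK (ltnW (leq_trans yj jx))) dvdn_addr // py.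
Qed.

(** Superadditivity of the floor: floor(x/d) >= floor(j/d) + floor((x - j)/d) for d = p^s. This
    gives the divisibility required of a p-ordering. *)
Lemma newton_val_min (p n j x : nat) :
  prime p -> (j <= x)%N -> (x < p ^ n)%N -> ~~ (p %| x)%N -> ~~ (p %| j)%N ->
  (newton_val p j j <= newton_val p j x)%N.
Proof.
move=> p_pr jx xn px pj.
rewrite (newton_valE p_pr jx xn px) (newton_valE p_pr (leqnn j) (leq_ltn_trans jx xn) pj).
rewrite leq_add2l; apply: leq_sum => s _; rewrite leq_mul2l; apply/orP; right.
rewrite subnn div0n subn0 leq_subRL ?leq_div2r ?leq_subr //.
by rewrite -{2}(subnK jx) divnD ?leq_addr // expn_gt0 prime_gt0.
Qed.

(** * The digit formula *)

Lemma pdigitE (p j s : nat) :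
  (pdigit p j s)%:Z = (j %/ p ^ s)%N%:Z - p%:Z * (j %/ p ^ s.+1)%N%:Z.
Proof.
rewrite /pdigit expnSr divnMA {2}(divn_eq (j %/ p ^ s) p).
by rewrite PoszD PoszM mulrC; ring.
Qed.

(** With q_s = floor(j / p^s), the sequences s q_s p^s and (s + 1) q_(s+1) p^s telescope. Their
    values at s = n are the last two terms, which vanish once j < p^n. *)
Lemma val_formulaE (p n j : nat) :
  val_formula p n j =
  - 1 + \sum_(s < n) ((j %/ p ^ s)%N%:Z - (j %/ p ^ s.+1)%N%:Z) * (p ^ s)%N%:Z
  - (j %/ p)%N%:Z - n%:Z * (j %/ p ^ n)%N%:Z * (p ^ n)%N%:Z
  + n.+1%:Z * (j %/ p ^ n.+1)%N%:Z * (p ^ n)%N%:Z.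
Proof.
rewrite /val_formula -!addrA; congr (_ + _).
elim: n => [|n IH]; first by rewrite !big_ord0 expn0 expn1 mul0r; ring.
rewrite !big_ord_recr /= IH !PoszM !pdigitE.
have -> : (p ^ n.+1)%N%:Z = p%:Z * (p ^ n)%N%:Z by rewrite expnS PoszM.
rewrite !(intS _.+1) !(intS n).
move: (\sum_(s < n) _) (j %/ p ^ n)%N%:Z (j %/ p ^ n.+1)%N%:Z (j %/ p ^ n.+2)%N%:Z.
move: (j %/ p)%N%:Z p%:Z (p ^ n)%N%:Z n%:Z => q r t k S a b c.
ring.
Qed.

(** The successor accounts for the multiple 0 of [p]. *)
Lemma count_nondivisible (p j : nat) : (0 < p)%N -> ~~ (p %| j)%N ->
  (\sum_(0 <= y < j | ~~ (p %| y)) 1 + (j %/ p).+1 = j)%N.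
Proof.
move=> p0 pj; have j0 : (0 < j)%N by case: j pj; rewrite ?dvdn0.
suff H k : (\sum_(0 <= y < k.+1 | ~~ (p %| y)) 1 + (k %/ p).+1 = k.+1)%N.
  case: j pj {j0} => [|k] pk; first by rewrite dvdn0 in pk.
  by rewrite divnS // (negPf pk) add0n H.
elim: k => [|k IH].
  by rewrite big_mkcond big_nat1 dvdn0 div0n.
rewrite big_mkcond big_nat_recr //= -big_mkcond divnS //=.
by move: (bigop _ _ _) IH => S IH; case: (p %| k.+1)%N => /=; lia.
Qed.

Lemma newton_val_formula (p n j : nat) :
  prime p -> (0 < n)%N -> (j < p ^ n)%N -> ~~ (p %| j)%N ->
  (newton_val p j j)%:Z = val_formula p n j.
Proof.
move=> p_pr n0 jn pj; have p0 := prime_gt0 p_pr.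
rewrite val_formulaE (newton_valE p_pr (leqnn j) jn pj) PoszD.
have jn1 : (j < p ^ n.+1)%N.
  by apply: (leq_trans jn); rewrite leq_exp2l // prime_gt1.
rewrite (divn_small jn) (divn_small jn1) !mulr0 !mul0r subr0 addr0.
have -> : (\sum_(0 <= y < j | ~~ (p %| y)) 1)%N%:Z = j%:Z - (j %/ p)%N%:Z - 1.
  have := count_nondivisible p0 pj.
  by move: (bigop _ _ _) (j %/ p)%N => S q; lia.
suff -> : \sum_(s < n) ((j %/ p ^ s)%N%:Z - (j %/ p ^ s.+1)%N%:Z) * (p ^ s)%N%:Z
   = j%:Z + (\sum_(1 <= s < n) (p ^ s - p ^ s.-1) * (j %/ p ^ s - (j - j) %/ p ^ s))%N%:Z.
  by ring.
(* The extra boundary term frees the identity from j < p^n, as induction on [n] requires. *)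
suff H : \sum_(s < n) ((j %/ p ^ s)%N%:Z - (j %/ p ^ s.+1)%N%:Z) * (p ^ s)%N%:Z
   = j%:Z + (\sum_(1 <= s < n) (p ^ s - p ^ s.-1) * (j %/ p ^ s - (j - j) %/ p ^ s))%N%:Z
     - (j %/ p ^ n)%N%:Z * (p ^ n.-1)%N%:Z.
  by rewrite H (divn_small jn) mul0r subr0.
rewrite subnn; elim: n n0 {jn jn1} => // -[_ _|n /(_ isT) IH _].
  by rewrite big_ord_recl big_ord0 big_geq // expn0 divn1; ring.
rewrite big_ord_recr big_nat_recr //= IH PoszD PoszM.
rewrite -subzn ?leq_exp2l ?prime_gt1 // div0n subn0; ring.
Qed.

(** * Newton interpolation over [T] *)

Lemma coef_prod_XsubC_T (p : nat) (z : algC) (x : nat -> algC) (k i : nat) :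
  prime p -> (forall b, (b < k)%N -> in_T p z (x b)) ->
  in_T p z (\prod_(b < k) ('X - (x b)%:P))`_i.
Proof.
move=> p_pr; elim: k i => [|k IH] i xT.
  by rewrite big_ord0 coef1; case: eqP => _; [apply: in_T1 | apply: in_T0].
have fT l := IH l (fun b bk => xT b (ltnW bk)).
rewrite big_ord_recr /= mulrBr coefB coefMX coefMC; apply: in_TB => //.
  by case: eqP => // _; apply: in_T0.
by apply: in_TM => //; apply: xT.
Qed.

(* The hypothesis on quotients says that [x] is a p-ordering in Bhargava's
   sense: the Newton basis polynomials [f_k = prod_(b < k) ('X - x_b)] satisfy
   [f_k(x_k) | f_k(x_c)] for all c. Hence passing from monomials to Newton
   polynomials turns the Vandermonde matrix into diag(f_k(x_k)) times an upper
   unitriangular matrix over T. *)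
Lemma vandermonde_p_ordering (p : nat) (z : algC) (m : nat) (x : nat -> algC)
    (f := fun k c => \prod_(b < k) (x c - x b)) :
  prime p -> (forall b, (b < m)%N -> in_T p z (x b)) ->
  (forall k, (k < m)%N -> f k k != 0) ->
  (forall k c, (k <= c)%N -> (c < m)%N -> in_T p z (f k c / f k k)) ->
  exists P Q : 'M_m, [/\ GL_T p z P, GL_T p z Q &
    P *m (\matrix_(l < m, c < m) x c ^+ l) *m Q = diag_mx (\row_k f k k)].
Proof.
move=> p_pr xT f0 fT; pose N k := \prod_(b < k) ('X - (x b)%:P).
have sN k : size (N k) = k.+1 by rewrite size_prod_XsubC /index_enum -enumT size_enum_ord.
pose P := \matrix_(k < m, l < m) (N k)`_l.
pose W := \matrix_(k < m, c < m) (if (k <= c)%N then f k c / f k k else 0).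
have PU : GL_T p z P.
  apply: GL_T_det1 => // [k l|].
    rewrite mxE; apply: coef_prod_XsubC_T => // b bk.
    exact: xT (ltn_trans bk (ltn_ord k)).
  rewrite det_trig; last first.
    by apply/is_trig_mxP => k l kl; rewrite mxE nth_default // sN.
  apply: big1 => k _; rewrite mxE.
  have /monicP := monic_prod_XsubC (index_enum 'I_k) xpredT (fun b : 'I_k => x b).
  by rewrite /lead_coef sN.
have WU : GL_T p z W.
  apply: GL_T_det1 => // [k c|].
    by rewrite mxE; case: ifP => kc; [apply: fT | apply: in_T0].
  rewrite -det_tr det_trig; last first.
    by apply/is_trig_mxP => k l kl; rewrite !mxE leqNgt kl.
  by apply: big1 => k _; rewrite !mxE leqnn divff // f0.
exists P, (invmx W); split=> //; first exact: GL_T_inv.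
have [uW _] := WU.
suff -> : P *m (\matrix_(l < m, c < m) x c ^+ l) = diag_mx (\row_k f k k) *m W.
  by rewrite mulmxK.
apply/matrixP => k c; rewrite mul_diag_mx !mxE.
have -> : \sum_l P k l * (\matrix_(l < m, c < m) x c ^+ l) l c = (N k).[x c].
  rewrite (@horner_coef_wide _ m) ?sN //.
  by apply: eq_bigr => l _; rewrite !mxE.
rewrite horner_prod (eq_bigr (fun b : 'I_k => x c - x b)); last first.
  by move=> b _; rewrite hornerXsubC.
case: leqP => [_|ck]; first by rewrite mulrC divfK // f0.
(* For c < k the node [x c] is a root of [N k]. *)
by rewrite mulr0 (bigD1 (Ordinal ck)) //= subrr mul0r.
Qed.

(** * Enumeration of the nodes and diagonalization of the Dedekind matrix *)

Lemma units_pn_split (p n j : nat) : (j < p ^ n)%N -> ~~ (p %| j)%N ->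
  units_pn p n = [seq i <- iota 0 j | ~~ (p %| i)%N] ++
    j :: [seq i <- iota j.+1 (p ^ n - j.+1) | ~~ (p %| i)%N].
Proof.
move=> jn pj; rewrite /units_pn -{1}(subnKC (ltnW jn)) iotaD filter_cat.
by rewrite -(subnSK jn) /= pj.
Qed.

Lemma size_units_pn (p n : nat) : prime p -> (0 < n)%N ->
  size (units_pn p n) = phi_pn p n.
Proof.
move=> p_pr n0; rewrite /phi_pn -totient_pfactor // totient_count_coprime.
rewrite /units_pn size_filter -sum1_count big_mkcond /index_iota subn0.
by apply: eq_bigr => i _; rewrite coprime_pexpl // prime_coprime //; case: (p %| i)%N.
Qed.

Lemma mem_units_pn (p n k : nat) : (k < size (units_pn p n))%N ->
  (nth 0%N (units_pn p n) k < p ^ n)%N /\ ~~ (p %| nth 0%N (units_pn p n) k)%N.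
Proof.
by move/(mem_nth 0%N); rewrite mem_filter mem_iota add0n => /andP[-> /andP[_ ->]].
Qed.

(** Turns a product over the first [k] nodes into one over the y < j prime to p, the form in which
    [newton_val] is defined. *)
Lemma take_units_pn (p n k : nat) (j := nth 0%N (units_pn p n) k) :
  (k < size (units_pn p n))%N ->
  take k (units_pn p n) = [seq i <- iota 0 j | ~~ (p %| i)%N].
Proof.
move=> kn; have [jn pj] := mem_units_pn kn; have := units_pn_split jn pj.
rewrite -/j; set s := filter _ (iota 0 j) => uE.
have uu : uniq (units_pn p n) by rewrite filter_uniq ?iota_uniq.
suff -> : k = size s by rewrite uE take_size_cat.
apply/eqP; rewrite -(nth_uniq 0%N kn _ uu); last first.
  by rewrite uE size_cat /= addnS ltnS leq_addr.
by rewrite -/j uE nth_cat ltnn subnn.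
Qed.

(** [Ncount] includes [j] itself while positions start at 0, hence the predecessor. *)
Lemma nth_units_pn (p n j : nat) : (j < p ^ n)%N -> ~~ (p %| j)%N ->
  ((Ncount p j).-1 < size (units_pn p n))%N /\
  nth 0%N (units_pn p n) (Ncount p j).-1 = j.
Proof.
move=> jn pj; have -> : (Ncount p j).-1 = size [seq i <- iota 0 j | ~~ (p %| i)%N].
  by rewrite /Ncount -addn1 iotaD count_cat /= add0n pj addn0 addn1 size_filter.
rewrite (units_pn_split jn pj); split; last by rewrite nth_cat ltnn subnn.
by rewrite size_cat /= addnS ltnS leq_addr.
Qed.

(** Each factor is -z^y (1 - z^(x - y)), and -z^y is a unit because z is a root of unity. *)
Lemma prod_sub_root (p n : nat) (z : algC) (j x : nat) :
  prime p -> (p ^ n)%N.-primitive_root z -> (j <= x)%N -> (x < p ^ n)%N ->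
  exists2 u, unit_T p z u &
    \prod_(0 <= y < j | ~~ (p %| y)%N) (z ^+ x - z ^+ y) =
    u * (1 - z) ^+ newton_val p j x.
Proof.
move=> p_pr z_pr jx xn; rewrite /newton_val big_seq_cond.
rewrite [(\sum_(0 <= y < j | _) _)%N]big_seq_cond.
elim/big_ind2: _ => [|a e b e' [u uU ->] [v vU ->]|y].
- by exists 1; [apply: unit_T1 | rewrite mulr1].
- by exists (u * v); [apply: unit_T_mul | rewrite mulrACA exprD].
rewrite mem_index_iota => /andP[/= yj _]; have yx := leq_trans yj jx.
have xy : (0 < x - y)%N by rewrite subn_gt0.
have lxy : (logn p (x - y) < n)%N.
  rewrite ltnNge -pfactor_dvdn //; apply/negP => /(dvdn_leq xy).
  by rewrite leqNgt (leq_ltn_trans (leq_subr _ _) xn).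
have [u uU uE] := one_sub_root_exp p_pr z_pr xy lxy.
have zT := in_T_root z p_pr.
have z0 : z != 0 by rewrite (prim_root_eq0 z_pr) -lt0n expn_gt0 prime_gt0.
exists (- z ^+ y * u); last first.
  by rewrite -mulrA -uE mulrBr mulr1 mulNr -exprD subnKC 1?ltnW // opprK addrC.
apply: unit_T_mul => //; split; first by apply/in_TN/in_TX.
split; first by rewrite oppr_eq0 expf_neq0.
rewrite invrN -exprVn; apply/in_TN/in_TX => //.
have q0 : (0 < p ^ n)%N by rewrite expn_gt0 prime_gt0.
have -> : z^-1 = z ^+ (p ^ n).-1; last exact: in_TX.
by apply: (mulfI z0); rewrite mulfV // -exprS prednK // prim_expr_order.
Qed.

Lemma dedekind_elem_div (p n : nat) (z : algC) :
  prime p -> (0 < n)%N -> (p ^ n)%N.-primitive_root z ->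
  elem_div_exps p z (dedekind_mx p n z) [seq newton_val p j j | j <- units_pn p n].
Proof.
move=> p_pr n0 z_pr; have zT := in_T_root z p_pr.
have q1 : (1 < p ^ n)%N by rewrite -(exp1n n) ltn_exp2r ?prime_gt1.
have t0 := one_sub_prim_root_neq0 q1 z_pr.
have tT : in_T p z (1 - z) by apply: in_TB => //; apply: in_T1.
set u := units_pn p n; have su : size u = phi_pn p n by apply: size_units_pn.
have u_mono k c : (k <= c)%N -> (c < size u)%N -> (nth 0%N u k <= nth 0%N u c)%N.
  move=> kc cu; apply: (sorted_leq_nth leq_trans leqnn) => //.
  - by apply: sorted_filter; [apply: leq_trans | apply: iota_sorted].
  - exact: leq_ltn_trans kc cu.
pose x b := z ^+ nth 0%N u b; pose f k c := \prod_(b < k) (x c - x b).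
have fE k c : (k <= c)%N -> (c < size u)%N -> exists2 v, unit_T p z v &
    f k c = v * (1 - z) ^+ newton_val p (nth 0%N u k) (nth 0%N u c).
  move=> kc cu; have ku := leq_ltn_trans kc cu.
  have [cn pc] := mem_units_pn cu.
  have [v vU vE] := prod_sub_root p_pr z_pr (u_mono k c kc cu) cn.
  exists v => //; rewrite -vE -big_filter /index_iota subn0 -(take_units_pn ku).
  rewrite (big_nth 0%N) size_take ku big_mkord; apply: eq_bigr => b _.
  by rewrite nth_take.
have f0 k : (k < size u)%N -> f k k != 0.
  by case/(fE k k (leqnn k)) => v [_ [v0 _]] ->; rewrite mulf_neq0 ?expf_neq0.
have fT k c : (k <= c)%N -> (c < size u)%N -> in_T p z (f k c / f k k).
  move=> kc cu; have ku := leq_ltn_trans kc cu.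
  have [v [vT _] ->] := fE k c kc cu; have [w [_ [w0 wV]] ->] := fE k k (leqnn k) ku.
  have [cn pc] := mem_units_pn cu; have [_ pk] := mem_units_pn ku.
  rewrite -(subnKC (newton_val_min p_pr (u_mono k c kc cu) cn pc pk)) exprD.
  rewrite invfM mulrACA; apply: in_TM => //; first exact: in_TM.
  by rewrite mulrAC mulfV ?expf_neq0 // mul1r; apply: in_TX.
split; first by rewrite size_map su.
split.
  apply/(sortedP 0%N) => i; rewrite size_map => iu.
  have iu' := ltnW iu; have [jn pj] := mem_units_pn iu'; have [xn px] := mem_units_pn iu.
  rewrite !(nth_map 0%N) //; have jx := u_mono i i.+1 (leqnSn i) iu.
  (* For successive nodes j < x, pass from (j, j) to (j, x) by minimality; going on to (x, x) only
     adds summands. *)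
  apply: leq_trans (newton_val_min p_pr jx xn px pj) _.
  by rewrite /newton_val [leqRHS](big_cat_nat (leq0n _) jx) //= leq_addr.
rewrite su in f0 fT fE u_mono.
have [|P [Q [PU QU PAQ]]] := vandermonde_p_ordering (x := x) p_pr _ f0 fT.
  by move=> b _; apply: in_TX.
exists P, Q; do 2!split=> //.
exists (fun i => f i i / (1 - z) ^+ newton_val p (nth 0%N u i) (nth 0%N u i)).
split=> [i|].
  by have [v vU ->] := fE i i (leqnn i) (ltn_ord i); rewrite mulfK ?expf_neq0.
have -> : dedekind_mx p n z = \matrix_(l, c) x c ^+ l.
  by apply/matrixP => l c; rewrite !mxE -exprM.
rewrite PAQ; congr diag_mx; apply/rowP => i; rewrite !mxE.
by rewrite (nth_map 0%N) ?su // divfK ?expf_neq0.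
Qed.

Theorem theorem2p7 (p n : nat) (z : algC) (j : nat) :
  prime p -> (0 < n)%N -> (p ^ n)%N.-primitive_root z ->
  (j < p ^ n)%N -> ~~ (p %| j)%N ->
  (exists e, elem_div_exps p z (dedekind_mx p n z) e) /\
  (forall e, elem_div_exps p z (dedekind_mx p n z) e ->
     (nth 0%N e (Ncount p j).-1)%:Z = val_formula p n j).
Proof.
move=> p_pr n0 z_pr jn pj; have e0 := dedekind_elem_div p_pr n0 z_pr.
split=> [|e eA]; first by eexists; exact: e0.
have q1 : (1 < p ^ n)%N by rewrite -(exp1n n) ltn_exp2r ?prime_gt1.
have [ku kj] := nth_units_pn jn pj.
have km := ku; rewrite size_units_pn // in km.
(* Uniqueness replaces the arbitrary [e] by the exhibited exponents. *)
rewrite (elem_div_exps_nth p_pr (one_sub_prim_root_neq0 q1 z_pr)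
  (one_sub_root_nonunit p_pr n0 z_pr) eA e0 km).
by rewrite (nth_map 0%N) // kj; apply: newton_val_formula.
Qed.
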